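(* For all pointed numerically generated spaces $X$ and $Y$, the space $Y^X = \nu\,\mathbf{smap}_0(X,Y)$ is weakly equivalent to the space $\mathbf{map}_0(X,Y)$ of pointed continuous maps equipped with the compact-open topology.
   Context: A topological space $X$ is numerically generated if it has the final topology with respect to all its singular simplexes (continuous maps $\Delta^n\to X$, $n\ge0$). For a topological space $X$, $\nu X$ is the underlying set of $X$ with the final topology with respect to all continuous maps into $X$ from open subsets of Euclidean spaces (equivalently, with respect to the singular simplexes of $X$). A map $f\colon X\to Y$ of topological spaces is numerically continuous if $f\sigma$ is continuous for every singular simplex $\sigma\colon\Delta^n\to X$. $\mathbf{map}(X,Y)$ is the set of continuous maps with the compact-open topology. $\mathbf{smap}(X,Y)$ is the set of numerically continuous maps with the initial topology with respect to the maps $\sigma^*\colon\mathbf{smap}(X,Y)\to\mathbf{map}(\Delta^n,Y)$, $f\mapsto f\sigma$, for all singular simplexes $\sigma$ of $X$. For pointed spaces, $\mathbf{map}_0(X,Y)$ and $\mathbf{smap}_0(X,Y)$ are the subspaces of basepoint preserving maps. Two spaces are weakly equivalent if they are connected by a finite zigzag of weak homotopy equivalences. *)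

(* Defs.v *)
From HB Require Import structures.
From mathcomp Require Import all_boot all_order all_algebra.
From mathcomp Require Import all_classical all_reals all_analysis.
From Stdlib Require Relation_Operators.

Set Implicit Arguments.
Unset Strict Implicit.
Unset Printing Implicit Defensive.

Import Order.TTheory GRing.Theory Num.Theory.
Import numFieldNormedType.Exports.
Local Open Scope classical_set_scope.
Local Open Scope ring_scope.

Definition final_topology {I : Type} {S : I -> Type} {T : Type}
  (f : forall i, S i -> T) : Type := T.

Section FinalTopology.
Context {I : Type} {S : I -> topologicalType} {T : choiceType}.
Variable f : forall i, S i -> T.

Definition final_open : set (set T) :=
  [set O | forall i, open (@f i @^-1` O)].

Local Lemma final_openT : final_open setT.
Proof. by move=> i; rewrite preimage_setT; exact: openT. Qed.

Local Lemma final_openI : setI_closed final_open.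
Proof. by move=> A B oA oB i; rewrite preimage_setI; exact: openI. Qed.

Local Lemma final_open_bigU (J : Type) (g : J -> set T) :
  (forall j, final_open (g j)) -> final_open (\bigcup_j g j).
Proof.
by move=> og i; rewrite preimage_bigcup; apply: bigcup_open => j _; exact: og.
Qed.

HB.instance Definition _ := Choice.on (final_topology f).
HB.instance Definition _ := isOpenTopological.Build (final_topology f)
  final_openT final_openI final_open_bigU.

End FinalTopology.

(* A set used as a type carries the subspace topology, here of
   ['rV[R]_n.+1]; likewise for domains of plots and for unit cubes. *)
Definition Delta (R : realType) (n : nat) : set 'rV[R]_n.+1 :=
  [set t | (forall i, 0 <= t 0 i) /\ \sum_i t 0 i = 1].

Arguments Delta : clear implicits.

Record singular_simplex (R : realType) (X : topologicalType) := SingularSimplex {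
  simplex_dim : nat;
  simplex_fun :> continuousType (Delta R simplex_dim) X }.

Record plot (R : realType) (X : topologicalType) := Plot {
  plot_dim : nat;
  plot_dom : set 'rV[R]_plot_dim;
  plot_dom_open : open plot_dom;
  plot_fun :> continuousType plot_dom X }.

Definition numerically_generated (R : realType) (X : topologicalType) : Prop :=
  forall U : set X, open U <->
    open (U : set (final_topology (@simplex_fun R X))).

Definition nu (R : realType) (X : topologicalType) : Type :=
  final_topology (@plot_fun R X).

HB.instance Definition _ (R : realType) (X : topologicalType) :=
  Topological.copy (nu R X) (final_topology (@plot_fun R X)).

Definition numerically_continuous (R : realType) (X Y : topologicalType)
    (f : X -> Y) : Prop :=
  forall s : singular_simplex R X, continuous (f \o s).

Definition map_space (X Y : topologicalType) : Type := continuousType X Y.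

HB.instance Definition _ (X Y : topologicalType) :=
  Topological.copy (map_space X Y)
    (initial_topology (id : continuousType X Y -> {compact-open, X -> Y})).

Record smap_space (R : realType) (X Y : topologicalType) := SMap {
  smap_fun :> X -> Y;
  smap_numerically_continuous : numerically_continuous R smap_fun }.

HB.instance Definition _ (R : realType) (X Y : topologicalType) :=
  gen_eqMixin (smap_space R X Y).
HB.instance Definition _ (R : realType) (X Y : topologicalType) :=
  gen_choiceMixin (smap_space R X Y).

Definition smap_pullback (R : realType) (X Y : topologicalType)
    (s : singular_simplex R X) (f : smap_space R X Y) :
    map_space (Delta R (simplex_dim s)) Y :=
  mkcts (@smap_numerically_continuous R X Y f s).

HB.instance Definition _ (R : realType) (X Y : topologicalType) :=
  Topological.copy (smap_space R X Y)
    (sup_topology (fun s : singular_simplex R X =>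
       Topological.class (initial_topology (@smap_pullback R X Y s)))).


Definition map0 (X Y : ptopologicalType) : set (map_space X Y) :=
  [set f | (f : continuousType X Y) point = point].

Arguments map0 : clear implicits.

Definition smap0 (R : realType) (X Y : ptopologicalType) :
    set (smap_space R X Y) :=
  [set f | f point = point].

Arguments smap0 : clear implicits.

Definition unit_interval (R : realType) : set R := `[0, 1].

Definition unit_cube (R : realType) (n : nat) : set 'rV[R]_n :=
  [set t | forall i, 0 <= t 0 i <= 1].

Arguments unit_interval : clear implicits.
Arguments unit_cube : clear implicits.

Definition cube_boundary (R : realType) (n : nat) : set (unit_cube R n) :=
  [set t | exists i, (set_val t : 'rV[R]_n) 0 i = 0 \/
                     (set_val t : 'rV[R]_n) 0 i = 1].

Section HomotopyGroups.
Variable R : realType.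

Definition path_related (A : topologicalType) (x y : A) : Prop :=
  exists g : continuousType (unit_interval R) A,
    (forall s, set_val s = 0 -> g s = x) /\
    (forall s, set_val s = 1 -> g s = y).

Definition pi0 (A : topologicalType) : set (set A) :=
  range (@path_related A).

Arguments pi0 A : clear implicits.

Definition pi0_map (A B : topologicalType) (f : A -> B) (C : set A) : set B :=
  [set y | exists2 x, C x & path_related (f x) y].

Definition spheroid (n : nat) (A : topologicalType) (a : A) :
    set (continuousType (unit_cube R n) A) :=
  [set g | forall t, cube_boundary t -> g t = a].

Arguments spheroid n {A} a.

Definition homotopic_rel_boundary (n : nat) (A : topologicalType)
    (g h : continuousType (unit_cube R n) A) : Prop :=
  exists H : continuousType (unit_cube R n * unit_interval R)%type A,
    [/\ forall t s, set_val s = 0 -> H (t, s) = g t,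
        forall t s, set_val s = 1 -> H (t, s) = h t &
        forall t s, cube_boundary t -> H (t, s) = g t].

(* Elements of [pi_n] are homotopy classes, as sets of spheroids. *)
Definition pi_n (n : nat) (A : topologicalType) (a : A) :
    set (set (continuousType (unit_cube R n) A)) :=
  [set homotopic_rel_boundary g | g in spheroid n a].

Arguments pi_n n {A} a.

Definition pi_n_map (n : nat) (A B : topologicalType) (f : continuousType A B)
    (C : set (continuousType (unit_cube R n) A)) :
    set (continuousType (unit_cube R n) B) :=
  [set h | exists2 g, C g & homotopic_rel_boundary (f \o g) h].

(* [pi_n_map f] is a group homomorphism for every continuous [f] and positive
   dimension, so being an isomorphism amounts to being bijective. *)
Definition weak_homotopy_equivalence (A B : topologicalType)
    (f : continuousType A B) : Prop :=
  set_bij (pi0 A) (pi0 B) (pi0_map f) /\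
  forall (n : nat) (a : A),
    set_bij (pi_n n.+1 a) (pi_n n.+1 (f a)) (@pi_n_map n.+1 A B f).

Definition weakly_equivalent : topologicalType -> topologicalType -> Prop :=
  Relation_Operators.clos_refl_sym_trans topologicalType
    (fun A B => exists f : continuousType A B, weak_homotopy_equivalence f).

End HomotopyGroups.

(* Main.v *)
Require Import Defs.
From HB Require Import structures.
From mathcomp Require Import all_boot all_order all_algebra.
From mathcomp Require Import all_classical all_reals all_analysis.
From mathcomp Require Import lra.

Set Implicit Arguments.
Unset Strict Implicit.
Unset Printing Implicit Defensive.

Import Order.TTheory GRing.Theory Num.Theory.
Import numFieldNormedType.Exports.
Local Open Scope classical_set_scope.
Local Open Scope ring_scope.

(** Since the topology of [X] is final for its singular simplexes, every
    numerically continuous map out of [X] is continuous: the two mapping spaces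
    have the same points and differ only in their topologies.  There are two
    evident continuous bijections

      [nu (smap0 X Y) --> smap0 X Y <-- map0 X Y],

    the first because plots are continuous, the second because precomposition
    with a simplex is continuous for the compact-open topologies.  Whether or
    not they are homeomorphisms, they induce bijections on the sets of
    continuous maps out of a space [Z] that is a cube, an interval, or a cube
    times an interval.  As homotopy groups are made of such maps and nothing
    else, both are weak homotopy equivalences ([weak_equivalence_of_lifts]).

    For [nu A --> A]: [Z] is a retract of some Euclidean space, so a continuous
    [Z -> A], composed with the retraction, is a plot of [A], and therefore
    lifts to [nu A] ([nu_lift_continuous]).

    For [map0 --> smap0] the argument is the exponential law, used twice
    ([smap_adjoint_continuous]).  Let [h : Z -> smap X Y] be continuous.  For
    each simplex [s : Delta -> X] the map [Z -> map (Delta, Y)] is continuous;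
    as [Delta] is compact Hausdorff, it corresponds to a continuous map
    [Delta -> map (Z, Y)].  These are the restrictions along the simplexes of
    one map [X -> map (Z, Y)], which is thus continuous because [X] is
    numerically generated.  As [Z] is compact Hausdorff, swapping back gives
    the continuity of [h] as a map [Z -> map (X, Y)]. *)

(** * Compact Hausdorff spaces, subspaces and row vectors *)

Lemma hausdorff_injective (S T : topologicalType) (f : S -> T) :
  continuous f -> injective f -> hausdorff_space T -> hausdorff_space S.
Proof.
move=> cf injf hT p q clpq; apply/injf/hT => A B nA nB.
have [z [Az Bz]] := clpq _ _ (cf _ _ nA) (cf _ _ nB).
by exists (f z).
Qed.

Lemma compact_locally_compact (T : topologicalType) :
  compact [set: T] -> locally_compact [set: T].
Proof.
move=> cT x _; exists setT; first exact: filterT.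
by split => //; exact: closedT.
Qed.

Lemma set_val_continuous (T : topologicalType) (A : set T) :
  continuous (set_val : A -> T).
Proof. exact: initial_continuous. Qed.

Lemma set_type_continuous (S T : topologicalType) (A : set T) (f : S -> A) :
  continuous (fun x => set_val (f x)) -> continuous f.
Proof. exact: continuous_comp_initial. Qed.

Lemma set_val_inj (T : Type) (A : set T) : injective (set_val : A -> T).
Proof. by rewrite set_valE; exact: val_inj. Qed.

Lemma compact_set_type (T : topologicalType) (A : set T) :
  compact A -> compact [set: A].
Proof.
move=> cA F FF _.
have FA : (set_val @ F) A.
  by apply: (@filterS _ F _ setT) => [x _|]; [exact: set_valP|exact: filterT].
have [p [Ap clp]] := cA _ _ FA.
exists (exist _ p (mem_set Ap)); split => // U V FU [_ [[W oW <-] Wp WV]].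
rewrite /= set_valE/= in Wp.
have [_ [[x Ux <-] Wx]] : set_val @` U `&` W !=set0.
  apply: clp; last by apply: open_nbhs_nbhs; split.
  by apply: (@filterS _ F _ U) => // y Uy; exists y.
by exists x; split => //; exact: WV.
Qed.

Lemma pair_continuous (S T U : topologicalType) (f : S -> T) (g : S -> U) :
  continuous f -> continuous g -> continuous (fun x => (f x, g x)).
Proof. by move=> cf cg x; apply: cvg_pair; [exact: cf|exact: cg]. Qed.

Lemma rV_continuous (S T : topologicalType) (n : nat) (f : S -> 'rV[T]_n) :
  (forall j, continuous (fun x => f x 0 j)) -> continuous f.
Proof.
move=> cf x U [P nP PU].
have : nbhs x (fun y => forall j, P 0 j (f y 0 j)).
  by apply: filter_forall => j; apply: (cf j); exact: nP.
by apply: filterS => y Py; apply: PU => i j; rewrite (ord1 i).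
Qed.

Lemma unit_cube_compact (R : realType) (n : nat) : compact (unit_cube R n).
Proof.
rewrite (_ : unit_cube R n = [set v | forall i, `[0, 1]%classic (v ord0 i)]).
  apply: (@rV_compact R n (fun=> `[0, 1]%classic)) => _.
  exact: segment_compact.
by apply/seteqP; split => v /= h i; have := h i; rewrite /= in_itv.
Qed.

(** The simplex is cut out of the cube by closed conditions. *)
Lemma Delta_compact (R : realType) (n : nat) : compact (Delta R n).
Proof.
apply: (subclosed_compact _ (@unit_cube_compact R n.+1)); last first.
  move=> t [t0 t1] i; rewrite t0 -t1 (bigD1 i)//= lerDl.
  by apply: sumr_ge0 => j _; exact: t0.
have -> : Delta R n =
    (\bigcap_i ((fun t : 'rV[R]_n.+1 => t 0 i) @^-1` [set x | 0 <= x])) `&`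
    ((fun t : 'rV[R]_n.+1 => \sum_i t 0 i) @^-1` [set 1]).
  by apply/seteqP; split => t [h1 h2]; split => // i; [move=> _|]; exact: h1.
apply: closedI.
  apply: closed_bigI => i _; apply: closed_comp; last exact: closed_ge.
  by move=> t _; exact: coord_continuous.
apply: closed_comp; last exact: closed_eq.
move=> t _; apply: (@continuous_big _ _ +%R 0 xpredT) => [|i _].
  exact: add_continuous.
exact: coord_continuous.
Qed.

(** * Retracts of cubes *)

Section CubeRetracts.
Variable R : realType.

Definition clamp (x : R) : R := Num.max 0 (Num.min x 1).

Lemma clamp_ge0_le1 x : 0 <= clamp x <= 1.
Proof. by rewrite /clamp le_max lexx ge_max ler01 ge_min lexx orbT. Qed.

Lemma clamp_id x : 0 <= x <= 1 -> clamp x = x.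
Proof. by rewrite /clamp => /andP[x0 x1]; rewrite min_l// max_r. Qed.

Lemma clamp_continuous : continuous clamp.
Proof.
move=> x; apply: (@continuous_max R R (cst 0) (fun y => Num.min y 1)).
  exact: cvg_cst.
by apply: (@continuous_min R R id (cst 1)); [exact: cvg_id|exact: cvg_cst].
Qed.

Lemma clamp_in_unit_interval x : clamp x \in unit_interval R.
Proof. by apply: mem_set; rewrite /unit_interval /= in_itv/= clamp_ge0_le1. Qed.

Definition to_interval (x : R) : unit_interval R :=
  exist _ (clamp x) (clamp_in_unit_interval x).

Lemma to_intervalE x : set_val (to_interval x) = clamp x.
Proof. by rewrite set_valE. Qed.

Lemma to_interval_continuous : continuous to_interval.
Proof.
apply: set_type_continuous; rewrite (_ : (fun x => _) = clamp).
  exact: clamp_continuous.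
by apply/funext => x; rewrite to_intervalE.
Qed.

Lemma interval_ge0_le1 (s : unit_interval R) : 0 <= set_val s <= 1.
Proof. by have := set_valP s; rewrite /unit_interval /= in_itv. Qed.

Lemma set_valK_interval : cancel set_val to_interval.
Proof.
move=> s; apply: set_val_inj.
by rewrite to_intervalE clamp_id// interval_ge0_le1.
Qed.

(** The property of the domains of spheroids, paths and their homotopies that
    the proof needs.  The retraction is defined on the whole Euclidean space,
    which is open, so that composing it with a map gives a plot; that the image
    lies in the unit cube makes the space compact. *)
Definition cube_retract (Z : topologicalType) : Prop :=
  exists m (i : Z -> 'rV[R]_m) (r : 'rV[R]_m -> Z),
    [/\ continuous i, continuous r, cancel i r & forall z, unit_cube R m (i z)].

Lemma cube_retract_compact (Z : topologicalType) :
  cube_retract Z -> compact [set: Z].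
Proof.
move=> [m [i [r [ci cr ir cubei]]]].
have -> : [set: Z] = r @` unit_cube R m.
  by apply/esym/seteqP; split => // z _; exists (i z).
apply: continuous_compact; last exact: unit_cube_compact.
exact: continuous_subspaceT.
Qed.

Lemma cube_retract_hausdorff (Z : topologicalType) :
  cube_retract Z -> hausdorff_space Z.
Proof.
move=> [m [i [r [ci _ /can_inj inji _]]]].
exact: (hausdorff_injective ci inji (@norm_hausdorff _ _)).
Qed.

Lemma clamp_in_unit_cube n (v : 'rV[R]_n) :
  \row_j clamp (v 0 j) \in unit_cube R n.
Proof. by apply: mem_set => j; rewrite mxE clamp_ge0_le1. Qed.

Definition to_cube n (v : 'rV[R]_n) : unit_cube R n :=
  exist _ (\row_j clamp (v 0 j)) (clamp_in_unit_cube v).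

Lemma to_cubeE n (v : 'rV[R]_n) j : set_val (to_cube v) 0 j = clamp (v 0 j).
Proof. by rewrite set_valE/= mxE. Qed.

Lemma cube_retract_cube n : cube_retract (unit_cube R n).
Proof.
exists n, set_val, (@to_cube n); split.
- exact: set_val_continuous.
- apply: set_type_continuous => /=; apply: rV_continuous => j.
  rewrite (_ : (fun _ => _) = clamp \o (fun v : 'rV[R]_n => v 0 j)).
    move=> v; apply: continuous_comp; first exact: coord_continuous.
    exact: clamp_continuous.
  by apply/funext => v; rewrite to_cubeE.
- move=> z; apply: set_val_inj; apply/rowP => j; rewrite to_cubeE clamp_id//.
  by have := set_valP z; exact.
- by move=> z; exact: set_valP.
Qed.

Lemma cube_retract_interval : cube_retract (unit_interval R).
Proof.
exists 1, (fun s => const_mx (set_val s)), (fun v => to_interval (v 0 0)).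
split.
- apply: rV_continuous => j; rewrite (_ : (fun _ => _) = set_val).
    exact: set_val_continuous.
  by apply/funext => s; rewrite mxE.
- move=> v; apply: (@continuous_comp _ _ _ (fun v : 'rV[R]_1 => v 0 0)).
    exact: coord_continuous.
  exact: to_interval_continuous.
- by move=> s; rewrite mxE set_valK_interval.
- by move=> s j; rewrite mxE interval_ge0_le1.
Qed.

Lemma cube_retract_prod (Z W : topologicalType) :
  cube_retract Z -> cube_retract W -> cube_retract (Z * W)%type.
Proof.
move=> [m [i [r [ci cr ir cubei]]]] [n [j [q [cj cq jq cubej]]]].
exists (m + n)%N, (fun z => row_mx (i z.1) (j z.2)),
  (fun v => (r (lsubmx v), q (rsubmx v))); split.
- apply: rV_continuous => k.
  have [l -> | l ->] := split_ordP k.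
    rewrite (_ : (fun _ => _) = (fun v : 'rV[R]_m => v 0 l) \o (i \o fst)).
      move=> z; apply: continuous_comp; last exact: coord_continuous.
      by apply: continuous_comp; [exact: cvg_fst|exact: ci].
    by apply/funext => z; rewrite row_mxEl.
  rewrite (_ : (fun _ => _) = (fun v : 'rV[R]_n => v 0 l) \o (j \o snd)).
    move=> z; apply: continuous_comp; last exact: coord_continuous.
    by apply: continuous_comp; [exact: cvg_snd|exact: cj].
  by apply/funext => z; rewrite row_mxEr.
- have cl : continuous (fun v : 'rV[R]_(m + n) => lsubmx v).
    apply: rV_continuous => k.
    rewrite (_ : (fun _ => _) = (fun v : 'rV[R]_(m + n) => v 0 (lshift n k))).
      by move=> ?; exact: coord_continuous.
    by apply/funext => w; rewrite mxE.
  have cr' : continuous (fun v : 'rV[R]_(m + n) => rsubmx v).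
    apply: rV_continuous => k.
    rewrite (_ : (fun _ => _) = (fun v : 'rV[R]_(m + n) => v 0 (rshift m k))).
      by move=> ?; exact: coord_continuous.
    by apply/funext => w; rewrite mxE.
  by apply: pair_continuous => v; [exact: (continuous_comp (cl v) (cr _))|
    exact: (continuous_comp (cr' v) (cq _))].
- by move=> [z w] /=; rewrite row_mxKl row_mxKr ir jq.
- move=> z k; rewrite mxE.
  by case: (fintype.split k) => l; [exact: (cubei z.1 l)|exact: (cubej z.2 l)].
Qed.

End CubeRetracts.

(** * Homotopies relative to a subset *)

Section Homotopies.
Variables (R : realType) (Z A : topologicalType).
Local Notation I := (unit_interval R).

(** Both the path relation and the homotopy relation on spheroids are instances
    of this one; the equivalence relation properties are proved once here. *)
Definition homotopic_rel (E : set Z) (g h : Z -> A) : Prop :=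
  exists H : Z * I -> A, [/\ continuous H,
    forall t s, set_val s = 0 -> H (t, s) = g t,
    forall t s, set_val s = 1 -> H (t, s) = h t &
    forall t s, E t -> H (t, s) = g t].

Lemma homotopic_rel_refl (E : set Z) (g : Z -> A) :
  continuous g -> homotopic_rel E g g.
Proof.
move=> cg; exists (g \o fst); split => // x.
by apply: continuous_comp; [exact: cvg_fst|exact: cg].
Qed.

(** Clamping the affine reparametrisation of the time to [0, 1] keeps it total,
    which spares the concatenation below any restriction of domains. *)
Lemma reparam_continuous (a b : R) :
  continuous (fun x : Z * I => (x.1, to_interval (a * set_val x.2 + b))).
Proof.
apply: pair_continuous => x; first exact: cvg_fst.
apply: (@continuous_comp _ _ _ (fun y : Z * I => a * set_val y.2 + b)).
  apply: cvgD; last exact: cvg_cst.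
  apply: cvgM; first exact: cvg_cst.
  by apply: continuous_comp; [exact: cvg_snd|exact: set_val_continuous].
exact: to_interval_continuous.
Qed.

Lemma homotopic_rel_sym (E : set Z) (g h : Z -> A) :
  homotopic_rel E g h -> homotopic_rel E h g.
Proof.
move=> [H [cH H0 H1 HE]].
exists (fun x => H (x.1, to_interval (-1 * set_val x.2 + 1))); split => /=.
- by move=> x; exact: (continuous_comp (@reparam_continuous (-1) 1 x) (cH _)).
- move=> t s s0; apply: H1; rewrite to_intervalE s0 mulr0 add0r clamp_id//.
  by rewrite ler01 lexx.
- move=> t s s1; apply: H0; rewrite to_intervalE s1 mulr1 addNr clamp_id//.
  by rewrite ler01 lexx.
- move=> t s Et; rewrite HE// -(HE t (to_interval 1) Et) H1//.
  by rewrite to_intervalE clamp_id// ler01 lexx.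
Qed.

(** Concatenation: [H] is run at double speed for times up to [1/2], then [K];
    continuity is the pasting lemma for the two closed halves. *)
Lemma homotopic_rel_trans (E : set Z) (g h k : Z -> A) :
  homotopic_rel E g h -> homotopic_rel E h k -> homotopic_rel E g k.
Proof.
move=> [H [cH H0 H1 HE]] [K [cK K0 K1 KE]].
pose HH (x : Z * I) := H (x.1, to_interval (2 * set_val x.2 + 0)).
pose KK (x : Z * I) := K (x.1, to_interval (2 * set_val x.2 - 1)).
have cHH : continuous HH.
  by move=> x; exact: (continuous_comp (@reparam_continuous 2 0 x) (cH _)).
have cKK : continuous KK.
  by move=> x; exact: (continuous_comp (@reparam_continuous 2 (-1) x) (cK _)).
have ch : continuous (fun x : Z * I => set_val x.2).
  move=> x; apply: continuous_comp; first exact: cvg_snd.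
  exact: set_val_continuous.
pose L := [set x : Z * I | set_val x.2 <= 2^-1].
pose U := [set x : Z * I | 2^-1 <= set_val x.2].
have cL : closed L.
  by apply: (@closed_comp _ _ _ [set y : R | y <= 2^-1]) => [x _|];
    [exact: ch|exact: closed_le].
have cU : closed U.
  by apply: (@closed_comp _ _ _ [set y : R | 2^-1 <= y]) => [x _|];
    [exact: ch|exact: closed_ge].
pose G (x : Z * I) := if set_val x.2 <= 2^-1 then HH x else KK x.
have GL x : L x -> G x = HH x by rewrite /G /L /= => ->.
have GU x : U x -> G x = KK x.
  rewrite /G /U /=; case: ifPn => // xL xU.
  have xE : set_val x.2 = 2^-1 by apply/eqP; rewrite eq_le xL.
  rewrite /HH /KK xE mulfV// addr0 subrr H1 ?K0//.
    by rewrite to_intervalE clamp_id// ler01 lexx.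
  by rewrite to_intervalE clamp_id// ler01 lexx.
exists G; split.
- apply/continuous_subspace_setT.
  rewrite (_ : [set: Z * I] = L `|` U); last first.
    apply/esym/seteqP; split => // x _; rewrite /L /U /=.
    by case: (leP (set_val x.2)) => h2; [left|right; exact: ltW].
  apply: withinU_continuous => //.
    apply: (subspace_eq_continuous (f := HH)); last exact: continuous_subspaceT.
    by move=> x /set_mem/GL.
  apply: (subspace_eq_continuous (f := KK)); last exact: continuous_subspaceT.
  by move=> x /set_mem/GU.
- move=> t s s0; rewrite GL /L /HH /= s0 ?invr_ge0 ?ler0n// H0//.
  by rewrite to_intervalE mulr0 addr0 clamp_id// ler01 lexx.
- move=> t s s1; rewrite GU /U /KK /= s1; last by lra.
  by rewrite K1// to_intervalE clamp_id; lra.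
- have gh t : E t -> h t = g t.
    move=> Et; rewrite -(HE t (to_interval 1) Et) H1// to_intervalE clamp_id//.
    by rewrite ler01 lexx.
  move=> t s Et; rewrite /G /=; case: ifP => _; first by rewrite /HH /= HE.
  by rewrite /KK /= KE// gh.
Qed.

End Homotopies.

(** * Maps with unique lifts are weak homotopy equivalences *)

Section WeakEquivalence.
Variable R : realType.
Local Notation I := (unit_interval R).

Lemma homotopic_rel_boundaryP (A : topologicalType) (n : nat)
    (g h : continuousType (unit_cube R n) A) :
  homotopic_rel_boundary g h <-> homotopic_rel R (@cube_boundary R n) g h.
Proof.
split=> [[H [H0 H1 HE]]|[H [cH H0 H1 HE]]]; last by exists (mkcts cH).
by exists H; split => //; exact: cts_fun.
Qed.

(** A path is a homotopy between constant maps; [bool] is just some inhabited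
    space to carry them. *)
Lemma path_relatedP (A : topologicalType) (x y : A) :
  path_related R x y <->
  homotopic_rel R set0 (cst x : bool -> A) (cst y).
Proof.
split=> [[g [g0 g1]]|[H [cH H0 H1 _]]].
  exists (g \o snd); split => [z|t s|t s|//]; [|exact: g0|exact: g1].
  by apply: continuous_comp; [exact: cvg_snd|exact: cts_fun].
have cHt : continuous (fun s : I => H (true, s)).
  have cp : continuous (fun s : I => (true, s)).
    apply: (@pair_continuous _ _ _ (cst true) id); first exact: cst_continuous.
    by move=> s U.
  by move=> s; exact: (continuous_comp (cp s) (cH _)).
by exists (mkcts cHt); split => s; [exact: H0|exact: H1].
Qed.

Lemma homotopic_rel_comp (Z A B : topologicalType) (f : A -> B) (E : set Z)
    (g h : Z -> A) : continuous f ->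
  homotopic_rel R E g h -> homotopic_rel R E (f \o g) (f \o h).
Proof.
move=> cf [H [cH H0 H1 HE]]; exists (f \o H); split => [x|t s s0|t s s1|t s Et].
- by apply: continuous_comp; [exact: cH|exact: cf].
- by rewrite /= H0.
- by rewrite /= H1.
- by rewrite /= HE.
Qed.

Lemma path_related_refl (A : topologicalType) (x : A) : path_related R x x.
Proof. by apply/path_relatedP/homotopic_rel_refl => ?; exact: cvg_cst. Qed.

Lemma path_related_sym (A : topologicalType) (x y : A) :
  path_related R x y -> path_related R y x.
Proof. by move=> /path_relatedP/homotopic_rel_sym/path_relatedP. Qed.

Lemma path_related_trans (A : topologicalType) (x y z : A) :
  path_related R x y -> path_related R y z -> path_related R x z.
Proof.
move=> /path_relatedP xy /path_relatedP yz; apply/path_relatedP.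
exact: homotopic_rel_trans xy yz.
Qed.

Lemma path_related_comp (A B : topologicalType) (f : A -> B) (x y : A) :
  continuous f -> path_related R x y -> path_related R (f x) (f y).
Proof.
move=> cf /path_relatedP xy; apply/path_relatedP.
exact: homotopic_rel_comp xy.
Qed.

Lemma path_class_eq (A : topologicalType) (x y : A) :
  path_related R x y <-> @path_related R A x = path_related R y.
Proof.
split=> [xy|->]; last exact: path_related_refl.
apply/seteqP; split=> z; apply: path_related_trans => //.
exact: path_related_sym.
Qed.

Lemma homotopy_class_eq (A : topologicalType) (n : nat)
    (g h : continuousType (unit_cube R n) A) :
  homotopic_rel_boundary g h <->
  @homotopic_rel_boundary R n A g = homotopic_rel_boundary h.
Proof.
split=> [/homotopic_rel_boundaryP gh|->]; last first.
  by apply/homotopic_rel_boundaryP/homotopic_rel_refl/cts_fun.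
apply/seteqP; split=> k /homotopic_rel_boundaryP hk;
  apply/homotopic_rel_boundaryP; apply: homotopic_rel_trans hk => //.
exact: homotopic_rel_sym.
Qed.

Lemma pi0_map_class (A B : topologicalType) (f : A -> B) (x : A) :
  continuous f ->
  pi0_map R f (@path_related R A x) = @path_related R B (f x).
Proof.
move=> cf; apply/seteqP; split=> y.
  by move=> [x' xx']; apply: path_related_trans; exact: path_related_comp.
by move=> fxy; exists x => //; exact: path_related_refl.
Qed.

Lemma pi_n_map_class (A B : topologicalType) (n : nat)
    (f : continuousType A B) (g : continuousType (unit_cube R n) A) :
  pi_n_map f (homotopic_rel_boundary g) = homotopic_rel_boundary (f \o g).
Proof.
apply/seteqP; split=> k.
  move=> [g' /homotopic_rel_boundaryP gg' /homotopic_rel_boundaryP fg'k].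
  apply/homotopic_rel_boundaryP; apply: homotopic_rel_trans fg'k.
  by apply: homotopic_rel_comp gg'; exact: cts_fun.
by move=> fgk; exists g => //; apply/homotopy_class_eq.
Qed.

(** Spheroids lift, which gives surjectivity, and so do homotopies between
    images of spheroids, which gives injectivity.  The lifts have the right
    values at the ends and on the boundary because [f] is injective. *)
Lemma weak_equivalence_of_lifts (A B : topologicalType)
    (f : continuousType A B) :
  injective f ->
  (forall Z : topologicalType, cube_retract R Z ->
    forall h : Z -> B, continuous h ->
    exists2 h' : Z -> A, continuous h' & forall z, f (h' z) = h z) ->
  weak_homotopy_equivalence R f.
Proof.
move=> finj lift; have cf : continuous f by exact: cts_fun.
have cubeI := cube_retract_interval R; have cubeC := cube_retract_cube R.
split=> [|n a].
  split.
  - by move=> _ [x _ <-]; exists (f x) => //; rewrite pi0_map_class.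
  - move=> _ _ /set_mem[x _ <-] /set_mem[y _ <-].
    rewrite !pi0_map_class// => /path_class_eq[g [g0 g1]].
    have [g' cg' g'E] := lift _ cubeI g (@cts_fun _ _ g).
    apply/path_class_eq; exists (mkcts cg'); split => s hs; apply: finj.
      by rewrite [LHS]g'E g0.
    by rewrite [LHS]g'E g1.
  - move=> _ [b _ <-].
    have [g' _ g'E] := lift _ cubeI (cst b) (@cst_continuous _ _ b).
    exists (@path_related R A (g' (to_interval 0))).
      by exists (g' (to_interval 0)).
    by rewrite pi0_map_class// g'E.
split.
- move=> _ [g ga <-]; rewrite pi_n_map_class; exists (f \o g) => //.
  by move=> t tb /=; rewrite ga.
- move=> _ _ /set_mem[g ga <-] /set_mem[h ha <-].
  rewrite !pi_n_map_class => /homotopy_class_eq/homotopic_rel_boundaryP.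
  move=> [H [cH H0 H1 HE]]; apply/homotopy_class_eq/homotopic_rel_boundaryP.
  have [H' cH' H'E] := lift _ (cube_retract_prod (cubeC n.+1) cubeI) H cH.
  exists H'; split=> // t s hs; apply: finj; rewrite H'E.
  + exact: H0.
  + exact: H1.
  + exact: HE.
- move=> _ [h hb <-].
  have [h' ch' h'E] := lift _ (cubeC n.+1) h (@cts_fun _ _ h).
  exists (homotopic_rel_boundary (mkcts ch')).
    exists (mkcts ch') => // t tb; apply: finj; rewrite [LHS]h'E; exact: hb.
  rewrite pi_n_map_class; congr homotopic_rel_boundary.
  by apply/continuousEP => t; exact: h'E.
Qed.

End WeakEquivalence.

(** * The numerically generated topology *)

Lemma nu_lift_continuous (R : realType) (A Z : topologicalType) (h : Z -> A) :
  cube_retract R Z -> continuous h -> continuous (h : Z -> nu R A).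
Proof.
move=> [m [i [r [ci cr ir _]]]] ch; apply/continuousP => U oU.
have cp : continuous (fun w : [set: 'rV[R]_m] => h (r (set_val w))).
  move=> w; apply: continuous_comp; last exact: ch.
  by apply: continuous_comp; [exact: set_val_continuous|exact: cr].
pose toT (v : 'rV[R]_m) : [set: 'rV[R]_m] := exist _ v (mem_set I).
have cT : continuous (toT \o i).
  by apply: set_type_continuous; rewrite (_ : (fun _ => _) = i).
(* The plot is [h \o r], on the whole Euclidean space. *)
have := oU (Plot openT (mkcts cp)); move/((continuousP _).1 cT).
rewrite (_ : _ @^-1` _ = h @^-1` U)//.
by apply/seteqP; split=> z /=; rewrite /mkcts set_valE/= ir.
Qed.

Lemma nu_id_continuous (R : realType) (A : topologicalType) :
  continuous (id : nu R A -> A).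
Proof.
apply/continuousP => U oU; suff : final_open (@plot_fun R A) U by [].
move=> p; exact: ((continuousP _).1 (@cts_fun _ _ p) _ oU).
Qed.

Lemma nu_weak_equivalence (R : realType) (A : topologicalType) :
  weak_homotopy_equivalence R (mkcts (@nu_id_continuous R A)).
Proof.
apply: weak_equivalence_of_lifts => [x y //|Z cZ h ch].
by exists h => //; exact: nu_lift_continuous.
Qed.

Lemma numerically_generated_continuous (R : realType) (X W : topologicalType)
    (f : X -> W) : numerically_generated R X ->
  numerically_continuous R f -> continuous f.
Proof.
move=> numX cf; apply/continuousP => U oU; apply/numX.
suff : final_open (@simplex_fun R X) (f @^-1` U) by [].
move=> s; exact: ((continuousP _).1 (cf s) _ oU).
Qed.

(** * The exponential law *)

(** Both sides stand for the continuous maps [T * S -> W]: uncurrying needs a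
    locally compact Hausdorff source [T], currying is always possible. *)
Lemma exponential_swap (S T W : topologicalType)
    (f : S -> {compact-open, T -> W}) :
  locally_compact [set: T] -> hausdorff_space T -> continuous f ->
  (forall x, continuous (f x)) ->
  continuous ((fun t x => f x t) : T -> {compact-open, S -> W}) /\
  forall t, continuous (fun x => f x t).
Proof.
move=> lcT hT cf cfx.
have cu : continuous (uncurry (f : S -> T -> W)).
  exact: (continuous_uncurry lcT hT cf cfx).
have cs : continuous (fun p : T * S => f p.2 p.1).
  move=> p; apply: (@continuous_comp _ _ _ (fun p : T * S => (p.2, p.1))
    (uncurry (f : S -> T -> W))); last exact: cu.
  by apply: (@pair_continuous (T * S)%type S T snd fst) => q;
    [exact: cvg_snd|exact: cvg_fst].
exact: (continuous_curry cs).
Qed.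

(** * Comparison of the two mapping spaces *)

Lemma map_space_id_continuous (X Y : topologicalType) :
  continuous (id : map_space X Y -> {compact-open, X -> Y}).
Proof. exact: initial_continuous. Qed.

Lemma precomp_continuous (S X Y : topologicalType) (s : continuousType S X) :
  continuous ((fun g => g \o s) :
    {compact-open, X -> Y} -> {compact-open, S -> Y}).
Proof.
move=> g; apply/compact_open_cvgP; first exact/fmap_filter/nbhs_filter.
move=> K O cK oO gKO.
have csK : compact (s @` K).
  by apply: continuous_compact => //; apply/continuous_subspaceT/cts_fun.
apply: (@filterS _ (nbhs (g : {compact-open, X -> Y})) _
    [set k | k @` (s @` K) `<=` O]).
  by move=> k kO _ [x Kx <-]; apply: kO; exists (s x) => //; exists x.
apply: open_nbhs_nbhs; split; first exact: compact_open_open.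
by move=> _ [_ [x Kx <-] <-]; apply: gKO; exists x.
Qed.

Lemma smap_pullback_continuous (R : realType) (X Y : topologicalType)
    (s : singular_simplex R X) : continuous (@smap_pullback R X Y s).
Proof.
pose T (s' : singular_simplex R X) :=
  Topological.class (initial_topology (@smap_pullback R X Y s')).
move=> f; apply: cvg_trans (@initial_continuous _ _ (@smap_pullback R X Y s) f).
apply: cvg_app.
by have /(@cvg_sup _ _ T _ f (nbhs_filter _))/(_ s) :
  nbhs (f : smap_space R X Y) --> (f : smap_space R X Y) by exact: cvg_id.
Qed.

Lemma continuous_smap_space (R : realType) (X Y Z : topologicalType)
    (h : Z -> smap_space R X Y) :
  (forall s, continuous (@smap_pullback R X Y s \o h)) -> continuous h.
Proof.
move=> ch z; apply/cvg_sup => s.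
exact: (@continuous_comp_initial _ _ _ (@smap_pullback R X Y s) h (ch s) z).
Qed.

(** The heart of the proof: out of a cube retract [Z], continuity for the
    topology of [smap_space], which only tests compact sets that come from
    simplexes, already implies continuity for the compact-open topology.  The
    topology of [X] enters between two uses of the exponential law, when
    [x |-> h^~ x] is seen to be continuous because its restrictions to all
    simplexes are. *)
Lemma smap_adjoint_continuous (R : realType) (X Y Z : topologicalType)
    (h : Z -> smap_space R X Y) :
  numerically_generated R X -> cube_retract R Z -> continuous h ->
  continuous ((fun z => smap_fun (h z)) : Z -> {compact-open, X -> Y}).
Proof.
move=> numX cZ ch.
have lcZ := compact_locally_compact (cube_retract_compact cZ).
have hZ := cube_retract_hausdorff cZ.
have cs (s : singular_simplex R X) :
    continuous ((fun t z => h z (s t)) :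
      Delta R (simplex_dim s) -> {compact-open, Z -> Y}) /\
    forall t, continuous (fun z => h z (s t)).
  apply: (@exponential_swap Z (Delta R (simplex_dim s)) Y (fun z => h z \o s)).
  - exact/compact_locally_compact/compact_set_type/Delta_compact.
  - exact: (hausdorff_injective (@set_val_continuous _ _) (@set_val_inj _ _)
      (@norm_hausdorff _ _)).
  - move=> z.
    have cp := continuous_comp (ch z) (@smap_pullback_continuous _ _ _ s _).
    exact: (continuous_comp cp (@map_space_id_continuous _ _ _)).
  - by move=> z; exact: smap_numerically_continuous.
have cX : continuous ((fun x z => h z x) : X -> {compact-open, Z -> Y}).
  by apply: (numerically_generated_continuous numX) => s; exact: (cs s).1.
(* Each point of [X] is on a constant simplex, so [h] is pointwise continuous. *)
have vertex : const_mx 1 \in Delta R 0.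
  by apply: mem_set; split => [i|]; rewrite ?big_ord1 mxE.
have cXz x : continuous (fun z => h z x).
  pose s := SingularSimplex (mkcts (@cst_continuous (Delta R 0) X x)).
  pose t : Delta R 0 := exist _ (const_mx 1) vertex.
  exact: ((cs s).2 t).
exact: (exponential_swap lcZ hZ cX cXz).1.
Qed.

Lemma map_numerically_continuous (R : realType) (X Y : topologicalType)
    (g : map_space X Y) : numerically_continuous R (g : continuousType X Y).
Proof. by move=> s x; apply: continuous_comp; exact: cts_fun. Qed.

Definition map_to_smap (R : realType) (X Y : topologicalType)
    (g : map_space X Y) : smap_space R X Y :=
  SMap (@map_numerically_continuous R X Y g).

Lemma map_to_smap_continuous (R : realType) (X Y : topologicalType) :
  continuous (@map_to_smap R X Y).
Proof.
apply: continuous_smap_space => s; apply: continuous_comp_initial => g.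
exact: (continuous_comp (@map_space_id_continuous X Y g)
  (@precomp_continuous _ _ Y s g)).
Qed.

Lemma smap_ext (R : realType) (X Y : topologicalType) (f g : smap_space R X Y) :
  smap_fun f = smap_fun g -> f = g.
Proof.
case: f g => [f cf] [g cg] /= fg; subst g; congr SMap; exact: Prop_irrelevance.
Qed.

Lemma map_to_smap_pointed (R : realType) (X Y : ptopologicalType)
    (g : map0 X Y) :
  map_to_smap R (set_val g) \in smap0 R X Y.
Proof. by apply: mem_set; have := set_valP g. Qed.

Definition map0_to_smap0 (R : realType) (X Y : ptopologicalType)
    (g : map0 X Y) : smap0 R X Y :=
  exist _ (map_to_smap R (set_val g)) (map_to_smap_pointed R g).

Lemma map0_to_smap0_continuous (R : realType) (X Y : ptopologicalType) :
  continuous (@map0_to_smap0 R X Y).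
Proof.
apply: set_type_continuous.
rewrite (_ : (fun _ => _) = @map_to_smap R X Y \o set_val).
  move=> g; apply: continuous_comp; first exact: set_val_continuous.
  exact: map_to_smap_continuous.
by apply/funext => g; rewrite set_valE.
Qed.

Lemma map0_weak_equivalence (R : realType) (X Y : ptopologicalType) :
  numerically_generated R X ->
  weak_homotopy_equivalence R (mkcts (@map0_to_smap0_continuous R X Y)).
Proof.
move=> numX; apply: weak_equivalence_of_lifts => [g k gk|Z cZ h ch].
  apply/set_val_inj/continuousEP => x.
  have := congr1 (fun f => smap_fun (set_val f) x) gk.
  by rewrite /mkcts !set_valE.
pose h0 z : smap_space R X Y := set_val (h z).
have ch0 : continuous h0.
  by move=> z; apply: continuous_comp; [exact: ch|exact: set_val_continuous].
have ch0z z : continuous (h0 z).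
  apply: (numerically_generated_continuous numX).
  exact: smap_numerically_continuous.
pose k z : map_space X Y := mkcts (ch0z z).
have kP z : k z \in map0 X Y by apply: mem_set; exact: (set_valP (h z)).
exists (fun z => exist _ (k z) (kP z) : map0 X Y).
  apply: set_type_continuous; rewrite (_ : (fun _ => _) = k).
    apply: continuous_comp_initial.
    exact: (smap_adjoint_continuous numX cZ ch0).
  by apply/funext => z; rewrite set_valE.
by move=> z; apply/set_val_inj/smap_ext; rewrite /mkcts !set_valE.
Qed.

Theorem corollary5p5 (R : realType) (X Y : ptopologicalType)
    (numX : numerically_generated R X) (numY : numerically_generated R Y) :
  weakly_equivalent R (nu R (smap0 R X Y)) (map0 X Y).
Proof.
apply: (@Relation_Operators.rst_trans _ _ _ (smap0 R X Y : topologicalType)).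
  apply: Relation_Operators.rst_step.
  exists (mkcts (@nu_id_continuous R (smap0 R X Y))).
  exact: nu_weak_equivalence.
apply/Relation_Operators.rst_sym/Relation_Operators.rst_step.
exists (mkcts (@map0_to_smap0_continuous R X Y)).
exact: map0_weak_equivalence.
Qed.
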